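(* Let $m_1,m_2\in\mathbb{N}$ and suppose $v\in\big[L^1((0,R))\big]^{m_1\times m_2}$ for all $R>0$. Let $\ell\ge 0$ and partition $u_0(\ell,z)=\{u_{0,jk}(\ell,z)\}_{j,k=1}^2$ into blocks, $u_{0,11}$ being $m_1\times m_1$ and $u_{0,22}$ being $m_2\times m_2$. Then for $z\in\mathbb{C}_+$ the matrix $u_{0,11}(\ell,z)+u_{0,12}(\ell,z)\varphi_0(z)$ is invertible and the Weyl–Titchmarsh functions $\varphi_\ell$ and $\varphi_0$ on $[\ell,\infty)$ and $[0,\infty)$ satisfy \[ \varphi_\ell(z)=\big(u_{0,21}(\ell,z)+u_{0,22}(\ell,z)\varphi_0(z)\big)\big(u_{0,11}(\ell,z)+u_{0,12}(\ell,z)\varphi_0(z)\big)^{-1}. \]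
   Context: Dirac-type system $y'(x,z)=i(zJ+JV(x))y(x,z)$, $x\ge0$, $m=m_1+m_2$, $J=\begin{bmatrix}I_{m_1}&0\\0&-I_{m_2}\end{bmatrix}$, $V=\begin{bmatrix}0_{m_1}&v\\ v^*&0_{m_2}\end{bmatrix}$. For $\ell\ge 0$, $u_\ell(x,z)$ is the $m\times m$ fundamental solution with $u_\ell(\ell,z)=I_m$. The Weyl–Titchmarsh function $\varphi_\ell(z)$ on $[\ell,\infty)$ is the (unique, existing) $m_2\times m_1$ matrix function holomorphic in $\mathbb{C}_+$ such that $u_\ell(\cdot,z)\begin{bmatrix}I_{m_1}\\ \varphi_\ell(z)\end{bmatrix}$ has entries in $L^2((\ell,\infty))$. *)

(* Defs.v *)
From HB Require Import structures.
From mathcomp Require Import all_boot all_order all_algebra.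
From mathcomp Require Import all_classical all_reals all_analysis.
From mathcomp Require Import complex.

Set Implicit Arguments.
Unset Strict Implicit.
Unset Printing Implicit Defensive.

Import Order.TTheory GRing.Theory Num.Theory.
Local Open Scope classical_set_scope.
Local Open Scope ring_scope.

Section Dirac.
Variable R : realType.
Local Notation C := (R[i]).
Local Notation leb := (@lebesgue_measure R).

Definition cintegrable (D : set R) (f : R -> C) : Prop :=
  leb.-integrable D (fun x => (complex.Re (f x))%:E) /\
  leb.-integrable D (fun x => (complex.Im (f x))%:E).

Definition cintegral (D : set R) (f : R -> C) : C :=
  Complex (Rintegral leb D (fun x => complex.Re (f x)))
          (Rintegral leb D (fun x => complex.Im (f x))).

Definition cL2_ray (l : R) (f : R -> C) : Prop :=
  measurable_fun `]l, +oo[ (fun x => complex.Re (f x)) /\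
  measurable_fun `]l, +oo[ (fun x => complex.Im (f x)) /\
  leb.-integrable `]l, +oo[
     (fun x => ((complex.Re (f x)) ^+ 2 + (complex.Im (f x)) ^+ 2)%:E).

Definition cdifferentiable_at (g : C -> C) (c : C) : Prop :=
  exists d : C, forall eps : R, 0 < eps -> exists2 delta : R, 0 < delta &
    forall h : C, h != 0 -> ComplexField.Normc.normc h < delta ->
      ComplexField.Normc.normc ((g (c + h) - g c) / h - d) < eps.

Definition holomorphic_upper (p q : nat) (F : C -> 'M[C]_(p, q)) : Prop :=
  forall j k (c : C), 0 < complex.Im c -> cdifferentiable_at (fun w => F w j k) c.

Variables m1 m2 : nat.

Definition Jmx : 'M[C]_(m1 + m2) :=
  block_mx (1%:M : 'M[C]_m1) 0 0 (- (1%:M : 'M[C]_m2)).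

Definition Vmx (v : R -> 'M[C]_(m1, m2)) (x : R) : 'M[C]_(m1 + m2) :=
  block_mx (0 : 'M[C]_m1) (v x) (map_mx (@conjc R) (v x)^T) (0 : 'M[C]_m2).

(* coefficient of the Dirac-type system y' = i (z J + J V(x)) y *)
Definition dirac_coef (v : R -> 'M[C]_(m1, m2)) (z : C) (x : R) : 'M[C]_(m1 + m2) :=
  (Complex 0 1) *: (z *: Jmx + Jmx *m Vmx v x).

(* u is the fundamental solution normalized at l: u(l,z) = I_m and, for every z,
   u(.,z) is an (absolutely continuous) solution on [0,+oo), i.e. for all 0 <= y <= x,
   u(x,z) = u(y,z) + \int_y^x i(zJ + JV(t)) u(t,z) dt (Lebesgue integral, integrand integrable). *)
Definition fund_sol (v : R -> 'M[C]_(m1, m2)) (l : R)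
    (u : R -> C -> 'M[C]_(m1 + m2)) : Prop :=
  forall z : C, u l z = 1%:M /\
    forall y x : R, 0 <= y -> y <= x -> forall j k,
      cintegrable `[y, x] (fun t => (dirac_coef v z t *m u t z) j k) /\
      u x z j k = u y z j k + cintegral `[y, x] (fun t => (dirac_coef v z t *m u t z) j k).

Definition weyl_fun (l : R) (u : R -> C -> 'M[C]_(m1 + m2))
    (phi : C -> 'M[C]_(m2, m1)) : Prop :=
  holomorphic_upper phi /\
  forall z : C, 0 < complex.Im z -> forall j k,
    cL2_ray l (fun x => (u x z *m col_mx (1%:M : 'M[C]_m1) (phi z)) j k).

End Dirac.

(* Main.v *)
Require Import Defs.
From HB Require Import structures.
From mathcomp Require Import all_boot all_order all_algebra.
From mathcomp Require Import all_classical all_reals all_analysis.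
From mathcomp Require Import measurable_realfun complex.
From mathcomp Require Import ring lra.

Set Implicit Arguments.
Unset Strict Implicit.
Unset Printing Implicit Defensive.

Import Order.TTheory GRing.Theory Num.Theory numFieldNormedType.Exports.
Local Open Scope classical_set_scope.
Local Open Scope ring_scope.

(* For solutions y, w of the system with parameters z, zeta the product rule gives
   (y^* J w)' = i (zeta - conj z) y^* w.  With zeta = conj z the form y^* J w is
   constant, so fundamental solutions are invertible and every solution is
   u_l(x,z) y(l): no Gronwall argument is needed.  With zeta = z the form y^* J y is
   nonincreasing on C_+, so a solution that is square integrable on (l,oo) has
   y(l)^* J y(l) >= 0, i.e. its lower block at l is dominated by its upper block.
   This makes u_11 + u_12 phi_0 injective, and forces two candidates for phi_l to
   coincide, one of them being read off from u_0(x,z) = u_l(x,z) u_0(l,z). *)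

(** * Real primitives and integration by parts *)

Section Primitives.
Variable R : realType.
Local Notation leb := (@lebesgue_measure R).
Implicit Types (f g df dg : R -> R).

Lemma integrable_restrictR (A : set R) f : measurable A ->
  leb.-integrable A (EFin \o f) <-> leb.-integrable setT (EFin \o (f \_ A)).
Proof.
move=> mA; have := @integrable_mkcond _ _ _ leb A (EFin \o f) mA.
by rewrite restrict_EFin.
Qed.

(** Serves to identify the slices of the planar integrand below: for one variable fixed, a Fubini
    slice is an extended-valued integral of exactly this shape. *)
Lemma integral_scale_restrict (c : R) (A : set R) f :
  measurable A -> leb.-integrable A (EFin \o f) ->
  (\int[leb]_t (c * (f \_ A) t)%:E)%E = (c * \int[leb]_(t in A) f t)%:E.
Proof.
move=> mA fi.
have fAi : leb.-integrable setT (EFin \o (f \_ A)).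
  exact: (integrable_restrictR f mA).1.
under eq_integral do rewrite EFinM.
rewrite (integralZl measurableT fAi) Rintegral_mkcond EFinM /Rintegral fineK//.
exact: integrable_fin_num.
Qed.

(* Fubini on the triangle a <= t <= s <= b. *)
Lemma Rintegral_triangle a b f g :
  leb.-integrable `[a, b] (EFin \o f) -> leb.-integrable `[a, b] (EFin \o g) ->
  leb.-integrable `[a, b] (EFin \o (fun s => f s * \int[leb]_(t in `[a, s]) g t)) /\
  \int[leb]_(s in `[a, b]) (f s * \int[leb]_(t in `[a, s]) g t) =
  \int[leb]_(t in `[a, b]) (g t * \int[leb]_(s in `[t, b]) f s).
Proof.
move=> fi gi.
pose D := `[a, b]%classic : set R.
have mD : measurable D by exact: measurable_itv.
pose F := f \_ D; pose G := g \_ D.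
have Fi : leb.-integrable setT (EFin \o F).
  exact: (integrable_restrictR f mD).1.
have Gi : leb.-integrable setT (EFin \o G).
  exact: (integrable_restrictR g mD).1.
have mF : measurable_fun setT F by apply/measurable_EFinP; exact: measurable_int Fi.
have mG : measurable_fun setT G by apply/measurable_EFinP; exact: measurable_int Gi.
pose T := [set p : R * R | p.2 <= p.1].
have mT : measurable T.
  have -> : T = (fun p : R * R => p.1 - p.2) @^-1` `[0, +oo[.
    by apply/seteqP; split => -[s t]; rewrite /T /= in_itv /= andbT subr_ge0.
  rewrite -[X in measurable X]setTI.
  apply: measurable_funB => //; exact: measurable_itv.
(* The integrand is extended by zero to the whole plane, with the triangle encoded by an indicator;
   both sides of the claim are then iterated integrals of [h]. *)
pose h (p : R * R) := (F p.1 * G p.2 * \1_T p)%:E.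
have mFG : measurable_fun setT (fun p : R * R => F p.1 * G p.2).
  by apply: measurable_funM; apply: measurableT_comp.
have mh : measurable_fun setT h.
  by apply/measurable_EFinP; apply: measurable_funM => //; exact: measurable_indic.
have hi : (leb \x leb)%E.-integrable setT h.
  (* [h] is dominated by F(s) G(t), which is integrable by Tonelli: its absolute iterated integral
     is the product of two finite integrals. *)
  apply (@le_integrable _ _ _ (leb \x leb)%E _ measurableT _
    (fun p => (F p.1 * G p.2)%:E) mh).
    move=> [s t] _ /=; rewrite lee_fin normrM ler_piMr// indicE.
    by case: (_ \in _); rewrite /= ?normr1 ?normr0.
  apply/integrable12ltyP; first exact/measurable_EFinP.
  under eq_integral.
    move=> s _; under eq_integral do rewrite /= normrM EFinM.
    rewrite integralZl//; last exact: (integrable_abse Gi).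
    over.
  have cF : (\int[leb]_t `|G t|%:E)%E \is a fin_num.
    by apply: integrable_fin_num => //; exact: (integrable_abse Gi).
  rewrite -(fineK cF) integralZr//; last exact: (integrable_abse Fi).
  rewrite ltey_eq fin_numM//.
  by apply: integrable_fin_num => //; exact: (integrable_abse Fi).
have FE s : fubini_F leb h s =
    ((fun s => f s * \int[leb]_(t in `[a, s]) g t) \_ D s)%:E.
  rewrite /fubini_F /h /= [in RHS]/patch; case: ifPn => sD; last first.
    have F0 : F s = 0 by rewrite /F /patch (negbTE sD).
    under eq_integral do rewrite F0 !mul0r.
    by rewrite integral0.
  move: (sD); rewrite inE /D /= in_itv /= => /andP[as_ sb].
  rewrite -integral_scale_restrict//; last first.
    apply: integrableS gi => // t /=; rewrite !in_itv /= => /andP[-> ts].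
    exact: le_trans ts sb.
  apply: eq_integral => t _; rewrite /F patchT// -mulrA; congr (_ * _)%:E.
  rewrite /G /patch indicE /T.
  have [ts|ts] := leP t s.
    rewrite (_ : (s, t) \in _); last by rewrite inE.
    rewrite mulr1; congr (if _ then _ else _).
    rewrite /D; apply/idP/idP; rewrite !inE /= !in_itv /= => /andP[-> _] //=.
    exact: le_trans ts sb.
  rewrite (_ : (s, t) \in _ = false); last first.
    by apply/negbTE; rewrite notin_setE /=; apply/negP; rewrite -ltNge.
  rewrite mulr0 ifF//; apply/negbTE; rewrite notin_setE /= in_itv /=.
  by apply/negP; rewrite negb_and -!ltNge ts orbT.
have GE t : fubini_G leb h t =
    ((fun t => g t * \int[leb]_(s in `[t, b]) f s) \_ D t)%:E.
  rewrite /fubini_G /h /= [in RHS]/patch; case: ifPn => tD; last first.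
    have G0 : G t = 0 by rewrite /G /patch (negbTE tD).
    under eq_integral do rewrite G0 mulr0 mul0r.
    by rewrite integral0.
  move: (tD); rewrite inE /D /= in_itv /= => /andP[at_ tb].
  rewrite -integral_scale_restrict//; last first.
    apply: integrableS fi => // s /=; rewrite !in_itv /= => /andP[ts ->].
    by rewrite (le_trans at_ ts).
  apply: eq_integral => s _; rewrite /G patchT// mulrAC mulrC; congr (_ * _)%:E.
  rewrite /F /patch indicE /T.
  have [ts|ts] := leP t s.
    rewrite (_ : (s, t) \in _); last by rewrite inE.
    rewrite mulr1; congr (if _ then _ else _).
    rewrite /D; apply/idP/idP; rewrite !inE /= !in_itv /= => /andP[_ ->] //=.
      by rewrite ts.
    by rewrite (le_trans at_ ts).
  rewrite (_ : (s, t) \in _ = false); last first.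
    by apply/negbTE; rewrite notin_setE /=; apply/negP; rewrite -ltNge.
  rewrite mulr0 ifF//; apply/negbTE; rewrite notin_setE /= in_itv /=.
  by apply/negP; rewrite negb_and -!ltNge ts.
split.
  apply: (integrable_restrictR _ mD).2.
  rewrite (_ : EFin \o _ = fubini_F leb h); first exact: (integrable_fubini_F hi).
  by apply/funext => s; rewrite FE.
rewrite Rintegral_mkcond [RHS]Rintegral_mkcond /Rintegral; congr fine.
transitivity (\int[leb]_s fubini_F leb h s)%E.
  by apply: eq_integral => s _; rewrite FE.
transitivity (\int[leb]_t fubini_G leb h t)%E; last first.
  by apply: eq_integral => t _; rewrite GE.
exact: (Fubini hi).
Qed.

(** Local absolute continuity on [0,oo) in integral form, with [df] as density. Nothing is
    differentiated pointwise, so calculus rules become identities between integrals. *)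
Definition rprimitive f df : Prop := forall y x, 0 <= y -> y <= x ->
  leb.-integrable `[y, x] (EFin \o df) /\
  f x = f y + \int[leb]_(t in `[y, x]) df t.

Lemma rprimitive_cst (c : R) : rprimitive (fun=> c) (fun=> 0).
Proof.
move=> y x y0 yx; split; first exact: integrable0.
by rewrite Rintegral_cst// mul0r addr0.
Qed.

Lemma rprimitiveD f df g dg : rprimitive f df -> rprimitive g dg ->
  rprimitive (fun x => f x + g x) (fun x => df x + dg x).
Proof.
move=> fP gP y x y0 yx.
have [fi fE] := fP _ _ y0 yx; have [gi gE] := gP _ _ y0 yx; split.
  by apply: eq_integrable (integrableD _ fi gi).
by rewrite RintegralD// fE gE addrACA.
Qed.

Lemma rprimitiveN f df : rprimitive f df ->
  rprimitive (fun x => - f x) (fun x => - df x).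
Proof.
move=> fP y x y0 yx; have [fi fE] := fP _ _ y0 yx; split.
  by apply: eq_integrable (integrableN fi).
under eq_Rintegral do rewrite -mulN1r.
by rewrite RintegralZl// fE mulN1r opprD.
Qed.

(** Integration by parts is the triangle identity with each inner integral evaluated as an increment
    of f or g. *)
Lemma rprimitiveM f df g dg : rprimitive f df -> rprimitive g dg ->
  rprimitive (fun x => f x * g x) (fun x => df x * g x + f x * dg x).
Proof.
move=> fP gP y x y0 yx.
(* Writing q(s) as q(y) plus the integral of dq over [y,s] splits dp q into a triangle integrand and
   a multiple of dp. This also yields integrability of dp q, and is used with f and g in both
   orders. *)
have key p dp q dq : rprimitive p dp -> rprimitive q dq ->
    leb.-integrable `[y, x] (EFin \o (fun s => dp s * q s)) /\
    \int[leb]_(s in `[y, x]) (dp s * \int[leb]_(t in `[y, s]) dq t) =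
    \int[leb]_(s in `[y, x]) (dp s * q s) - (p x - p y) * q y.
  move=> pP qP.
  have [pi pE] := pP _ _ y0 yx; have [qi qE] := qP _ _ y0 yx.
  have [ti _] := Rintegral_triangle pi qi.
  have sE : {in `[y, x]%classic, (fun s => dp s * q s) =1
      (fun s => dp s * \int[leb]_(t in `[y, s]) dq t + q y * dp s)}.
    move=> s; rewrite inE /= in_itv /= => /andP[ys _].
    have [_ ->] := qP _ _ y0 ys; ring.
  have qi' : leb.-integrable `[y, x] (EFin \o (fun s => q y * dp s)).
    by apply: eq_integrable (integrableZl _ (q y) pi).
  split.
    apply: eq_integrable (integrableD _ ti qi') => //.
    by move=> s /sE /= ->.
  have -> : \int[leb]_(s in `[y, x]) (dp s * q s) = \int[leb]_(s in `[y, x])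
      (dp s * \int[leb]_(t in `[y, s]) dq t + q y * dp s).
    by apply: eq_Rintegral => s /sE.
  rewrite RintegralD// RintegralZl// pE; ring.
have [fgi fgE] := key _ _ _ _ fP gP.
have [gfi _] := key _ _ _ _ gP fP.
have [fi fE] := fP _ _ y0 yx; have [gi gE] := gP _ _ y0 yx.
have gfi' : leb.-integrable `[y, x] (EFin \o (fun s => f s * dg s)).
  by apply: eq_integrable gfi => // s _ /=; rewrite mulrC.
split; first by apply: eq_integrable (integrableD _ fgi gfi').
have [_] := Rintegral_triangle fi gi; rewrite fgE.
have -> : \int[leb]_(t in `[y, x]) (dg t * \int[leb]_(s in `[t, x]) df s) =
    f x * (g x - g y) - \int[leb]_(t in `[y, x]) (f t * dg t).
  have gi' : leb.-integrable `[y, x] (EFin \o (fun s => f x * dg s)).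
    by apply: eq_integrable (integrableZl _ (f x) gi).
  transitivity (\int[leb]_(t in `[y, x]) (f x * dg t - f t * dg t)).
    apply: eq_Rintegral => t; rewrite inE /= in_itv /= => /andP[yt tx].
    have [_ ->] := fP _ _ (le_trans y0 yt) tx; ring.
  rewrite RintegralB// RintegralZl// gE; ring.
rewrite RintegralD// => E; lra.
Qed.

End Primitives.

(** * Complex and matrix primitives *)

Section Dirac.
Variable R : realType.
Local Notation C := (R[i]).
Local Notation leb := (@lebesgue_measure R).
Local Notation Re := (@complex.Re R).
Local Notation Im := (@complex.Im R).

(** This is the integral equation of [fund_sol] for one entry, so that a fundamental solution is a
    matrix primitive by unfolding. *)
Definition cprimitive (f df : R -> C) : Prop := forall y x, 0 <= y -> y <= x ->
  cintegrable `[y, x] df /\ f x = f y + cintegral `[y, x] df.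

Lemma cprimitiveP (f df : R -> C) : cprimitive f df <->
  rprimitive (Re \o f) (Re \o df) /\ rprimitive (Im \o f) (Im \o df).
Proof.
split=> [fP|[rP iP] y x y0 yx].
  split=> y x y0 yx; have [[ri ii] E] := fP _ _ y0 yx; split => //=.
    by rewrite E; case: (f y).
  by rewrite E; case: (f y).
have [ri rE] := rP _ _ y0 yx; have [ii iE] := iP _ _ y0 yx; split=> //.
by move: rE iE => /=; case: (f x) (f y) => [? ?] [? ?] /= -> ->.
Qed.

Lemma cprimitive_cst (c : C) : cprimitive (fun=> c) (fun=> 0).
Proof. by apply/cprimitiveP; split; exact: rprimitive_cst. Qed.

Lemma cprimitiveD (f df g dg : R -> C) : cprimitive f df -> cprimitive g dg ->
  cprimitive (fun x => f x + g x) (fun x => df x + dg x).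
Proof.
have ReD (p q : C) : Re (p + q) = Re p + Re q by case: p q => [? ?] [].
have ImD (p q : C) : Im (p + q) = Im p + Im q by case: p q => [? ?] [].
move=> /cprimitiveP[fr fi] /cprimitiveP[gr gi]; apply/cprimitiveP; split.
  by move: (rprimitiveD fr gr); congr rprimitive; apply/funext => x /=; rewrite ReD.
by move: (rprimitiveD fi gi); congr rprimitive; apply/funext => x /=; rewrite ImD.
Qed.

Lemma cprimitiveM (f df g dg : R -> C) : cprimitive f df -> cprimitive g dg ->
  cprimitive (fun x => f x * g x) (fun x => df x * g x + f x * dg x).
Proof.
move=> /cprimitiveP[fr fi] /cprimitiveP[gr gi]; apply/cprimitiveP; split.
  move: (rprimitiveD (rprimitiveM fr gr) (rprimitiveN (rprimitiveM fi gi))).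
  congr rprimitive; apply/funext => x /=.
    by case: (f x) (g x) => [? ?] [? ?] /=.
  case: (f x) (g x) (df x) (dg x) => [? ?] [? ?] [? ?] [? ?] /=; ring.
move: (rprimitiveD (rprimitiveM fr gi) (rprimitiveM fi gr)).
congr rprimitive; apply/funext => x /=.
  by case: (f x) (g x) => [? ?] [? ?] /=.
case: (f x) (g x) (df x) (dg x) => [? ?] [? ?] [? ?] [? ?] /=; ring.
Qed.

Lemma cprimitive_conj (f df : R -> C) : cprimitive f df ->
  cprimitive (fun x => conjc (f x)) (fun x => conjc (df x)).
Proof.
move=> /cprimitiveP[fr fi]; apply/cprimitiveP; split.
  by move: fr; congr rprimitive; apply/funext => x /=; [case: (f x)|case: (df x)].
by move: (rprimitiveN fi); congr rprimitive; apply/funext => x /=;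
  [case: (f x)|case: (df x)].
Qed.

Lemma cprimitive_sum (I : Type) (r : seq I) (f df : I -> R -> C) :
  (forall i, cprimitive (f i) (df i)) ->
  cprimitive (fun x => \sum_(i <- r) f i x) (fun x => \sum_(i <- r) df i x).
Proof.
move=> fP; elim: r => [|i r IH].
  by move: (cprimitive_cst 0); congr cprimitive; apply/funext => x; rewrite big_nil.
by move: (cprimitiveD (fP i) IH); congr cprimitive; apply/funext => x;
  rewrite big_cons.
Qed.

Definition mprimitive p q (A dA : R -> 'M[C]_(p, q)) : Prop :=
  forall j k, cprimitive (fun x => A x j k) (fun x => dA x j k).

Lemma mprimitive_cst p q (A : 'M[C]_(p, q)) : mprimitive (fun=> A) (fun=> 0).
Proof.
move=> j k; move: (cprimitive_cst (A j k)); congr cprimitive.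
by apply/funext => x; rewrite mxE.
Qed.

Lemma mprimitiveM p q r (A dA : R -> 'M[C]_(p, q)) (B dB : R -> 'M[C]_(q, r)) :
  mprimitive A dA -> mprimitive B dB ->
  mprimitive (fun x => A x *m B x) (fun x => dA x *m B x + A x *m dB x).
Proof.
move=> AP BP j k.
have := cprimitive_sum (index_enum 'I_q) (fun i => cprimitiveM (AP j i) (BP i k)).
congr cprimitive; apply/funext => x; first by rewrite mxE.
by rewrite !mxE big_split.
Qed.

Lemma mprimitive0 p q (A : R -> 'M[C]_(p, q)) : mprimitive A (fun=> 0) ->
  forall x y, 0 <= x -> 0 <= y -> A x = A y.
Proof.
move=> AP; suff H x y : 0 <= x -> x <= y -> A x = A y.
  by move=> x y x0 y0; case/orP: (le_total x y) => xy; [exact: H|exact/esym/H].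
move=> x0 xy; apply/matrixP => j k; have [_ ->] := AP j k _ _ x0 xy.
rewrite /cintegral; under eq_Rintegral do rewrite mxE.
rewrite Rintegral_cst// mul0r.
under eq_Rintegral do rewrite mxE; rewrite Rintegral_cst// mul0r.
by rewrite addr0.
Qed.

(** * Adjoints, the form y^* J w, and fundamental solutions *)

Definition adjmx p q (A : 'M[C]_(p, q)) : 'M[C]_(q, p) := map_mx conjc A^T.
Local Notation "A ^H" := (adjmx A) (at level 8, format "A ^H").

Lemma adjmxM p q r (A : 'M[C]_(p, q)) (B : 'M[C]_(q, r)) :
  (A *m B)^H = B^H *m A^H.
Proof. by rewrite /adjmx trmx_mul map_mxM. Qed.

Lemma adjmx1 p : (1%:M : 'M[C]_p)^H = 1%:M.
Proof. by rewrite /adjmx trmx1 map_mx1. Qed.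

Lemma adjmxD p q (A B : 'M[C]_(p, q)) : (A + B)^H = A^H + B^H.
Proof. by apply/matrixP => j k; rewrite !mxE rmorphD. Qed.

Lemma adjmxZ p q a (A : 'M[C]_(p, q)) : (a *: A)^H = conjc a *: A^H.
Proof. by apply/matrixP => j k; rewrite !mxE rmorphM. Qed.

Lemma mprimitive_adj p q (A dA : R -> 'M[C]_(p, q)) : mprimitive A dA ->
  mprimitive (fun x => (A x)^H) (fun x => (dA x)^H).
Proof.
move=> AP j k; move: (cprimitive_conj (AP k j)); congr cprimitive;
by apply/funext => x; rewrite !mxE.
Qed.

Variables m1 m2 : nat.
Variable v : R -> 'M[C]_(m1, m2).
Local Notation J := (Jmx R m1 m2).

Lemma mulJJ : J *m J = 1%:M.
Proof.
by rewrite /Jmx mulmx_block !mul0mx !mulmx0 mulmxN mulNmx !mulmx1 opprK !addr0 add0r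
  -scalar_mx_block.
Qed.

Lemma adjJ : J^H = J.
Proof.
by rewrite /Jmx /adjmx tr_block_mx map_block_mx !trmx0 !map_mx0 linearN /= !trmx1
  map_mxN !map_mx1.
Qed.

Lemma adjV x : (Vmx v x)^H = Vmx v x.
Proof.
rewrite /Vmx /adjmx tr_block_mx map_block_mx !trmx0 !map_mx0; congr block_mx.
by apply/matrixP => j k; rewrite !mxE conjcK.
Qed.

(** The potential cancels: since J^2 = 1 and V^* = V, the two summands contribute -iV and iV, and
    only the spectral terms remain. *)
Lemma dirac_coef_J z w x :
  (dirac_coef v z x)^H *m J + J *m dirac_coef v w x = ('i%C * (w - conjc z))%:M.
Proof.
rewrite /dirac_coef !(adjmxZ, adjmxD, adjmxM) adjJ adjV.
have -> : conjc 'i%C = - 'i%C :> C by apply/eqP; rewrite eq_complex /= oppr0 !eqxx.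
rewrite -scalemxAl -scalemxAr mulmxDl mulmxDr -!scalemxAl -!scalemxAr.
rewrite mulmxA -(mulmxA (Vmx v x)) !mulJJ mulmx1 mul1mx.
rewrite scaleNr -scalerN -scalerDr opprD addrC addrA.
rewrite [w *: _ + _ + _]addrAC addrK -scalerBl scalerA.
by rewrite scale_scalar_mx mulr1.
Qed.

Lemma dirac_form p q z w (Y : R -> 'M[C]_(m1 + m2, p)) (W : R -> 'M[C]_(m1 + m2, q)) :
  mprimitive Y (fun x => dirac_coef v z x *m Y x) ->
  mprimitive W (fun x => dirac_coef v w x *m W x) ->
  mprimitive (fun x => (Y x)^H *m J *m W x)
    (fun x => ('i%C * (w - conjc z)) *: ((Y x)^H *m W x)).
Proof.
move=> YP WP j k.
(* Product rule applied twice, with J constant; the two surviving terms enclose the sum computed in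
   [dirac_coef_J] between Y^* and W. *)
have := mprimitiveM (mprimitiveM (mprimitive_adj YP) (mprimitive_cst J)) WP j k.
congr cprimitive; apply/funext => x; congr (fun_of_matrix _ j k).
rewrite mulmx0 addr0 adjmxM !mulmxA -mulmxDl -!mulmxA -mulmxDr.
by rewrite dirac_coef_J mul_mx_scalar scalemxAl.
Qed.

Lemma fund_sol_mprimitive l u z : fund_sol v l u ->
  mprimitive (u^~ z) (fun x => dirac_coef v z x *m u x z).
Proof. by move=> uP j k y x y0 yx; have [_ /(_ y x y0 yx j k)] := uP z. Qed.

(** The form pairing the parameters conj z and z is constant in x and equals J at x = l; a
    multiplication by J on the left turns this into an explicit left inverse. *)
Lemma fund_sol_inv l u z x : fund_sol v l u -> 0 <= l -> 0 <= x ->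
  (J *m (u x (conjc z))^H *m J) *m u x z = 1%:M.
Proof.
move=> uP l0 x0; rewrite -mulmxA -[J *m _ *m _]mulmxA -[RHS]mulJJ; congr (_ *m _).
have := dirac_form (fund_sol_mprimitive (conjc z) uP) (fund_sol_mprimitive z uP).
rewrite conjcK subrr mulr0.
under [X in mprimitive _ X]funext do rewrite scale0r.
move=> /mprimitive0 /(_ _ _ x0 l0) /=.
by rewrite mulmxA (uP z).1 (uP (conjc z)).1 adjmx1 mulmx1 mul1mx.
Qed.

(** Uniqueness for the initial value problem: constancy of the form between u(., conj z) and Y
    carries J Y(l) to x, where u(x, conj z) can be inverted. The point x may lie on either side of
    l. *)
Lemma sol_fund_sol l u z p (Y : R -> 'M[C]_(m1 + m2, p)) x :
  fund_sol v l u -> 0 <= l -> 0 <= x ->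
  mprimitive Y (fun x => dirac_coef v z x *m Y x) -> Y x = u x z *m Y l.
Proof.
move=> uP l0 x0 YP.
have := dirac_form (fund_sol_mprimitive (conjc z) uP) YP.
rewrite conjcK subrr mulr0.
under [X in mprimitive _ X]funext do rewrite scale0r.
move=> /mprimitive0 /(_ _ _ x0 l0) /=.
rewrite (uP (conjc z)).1 adjmx1 mul1mx => E.
(* For square matrices the left inverse is also a right inverse, so Y(x) can be rewritten as u(x,z)
   times the conserved quantity. *)
have := mulmx1C (fund_sol_inv z uP l0 x0).
move=> /(congr1 (fun A => A *m Y x)); rewrite mul1mx => <-.
by rewrite -!mulmxA (mulmxA _ J (Y x)) E (mulmxA J J) mulJJ mul1mx.
Qed.

(** * Square-integrable majorants on a ray *)

Definition sqnorm (c : C) : R := Re c ^+ 2 + Im c ^+ 2.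

Lemma sqnorm_ge0 c : 0 <= sqnorm c.
Proof. by rewrite addr_ge0// sqr_ge0. Qed.

Lemma sqnorm_eq0 c : (sqnorm c == 0) = (c == 0).
Proof. by rewrite paddr_eq0 ?sqr_ge0// !sqrf_eq0 eq_complex. Qed.

Lemma sqnormM a b : sqnorm (a * b) = sqnorm a * sqnorm b.
Proof. by rewrite /sqnorm; case: a b => [? ?] [? ?] /=; ring. Qed.

Lemma sqnormD_le a b : sqnorm (a + b) <= 2 * sqnorm a + 2 * sqnorm b.
Proof.
rewrite /sqnorm; case: a b => [a1 a2] [b1 b2] /=.
have := sqr_ge0 (a1 - b1); have := sqr_ge0 (a2 - b2); nra.
Qed.

(* Square-integrable domination: unlike cL2_ray it carries no measurability
   condition on f, so it is stable under pointwise linear combinations. *)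
Definition sqdom (l : R) (f : R -> C) : Prop := exists S : R -> R,
  leb.-integrable `]l, +oo[ (EFin \o S) /\ forall x, l < x -> sqnorm (f x) <= S x.

Lemma cL2_ray_sqdom l f : cL2_ray l f -> sqdom l f.
Proof. by case=> _ [_ fi]; exists (fun x => sqnorm (f x)). Qed.

Lemma sqdomS l l' f : l <= l' -> sqdom l f -> sqdom l' f.
Proof.
move=> ll' [S [Si fS]]; exists S; split; last first.
  by move=> x l'x; apply: fS; exact: le_lt_trans l'x.
apply: integrableS Si => // x /=; rewrite !in_itv /= !andbT.
exact: le_lt_trans.
Qed.

Lemma sqdom0 l : sqdom l (fun=> 0).
Proof.
exists (fun=> 0); split; first exact: integrable0.
by move=> x _; rewrite /sqnorm /= expr0n /= addr0.
Qed.

Lemma sqdomD l f g : sqdom l f -> sqdom l g -> sqdom l (fun x => f x + g x).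
Proof.
move=> [S [Si fS]] [T [Ti gT]]; exists (fun x => 2 * S x + 2 * T x); split.
  have Zi U : leb.-integrable `]l, +oo[ (EFin \o U) ->
      leb.-integrable `]l, +oo[ (EFin \o (fun x => 2 * U x)).
    by move=> Ui; apply: eq_integrable (integrableZl _ 2 Ui).
  by apply: eq_integrable (integrableD _ (Zi _ Si) (Zi _ Ti)).
move=> x lx; apply: le_trans (sqnormD_le _ _) _.
by rewrite lerD// ler_pM2l//; [exact: fS|exact: gT].
Qed.

Lemma sqdomZ l c f : sqdom l f -> sqdom l (fun x => f x * c).
Proof.
move=> [S [Si fS]]; exists (fun x => sqnorm c * S x); split.
  by apply: eq_integrable (integrableZl _ (sqnorm c) Si).
by move=> x lx; rewrite sqnormM mulrC ler_wpM2l ?sqnorm_ge0//; exact: fS.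
Qed.

Lemma sqdom_sum l (I : Type) (r : seq I) (f : I -> R -> C) :
  (forall i, sqdom l (f i)) -> sqdom l (fun x => \sum_(i <- r) f i x).
Proof.
move=> fP; elim: r => [|i r IH].
  by move: (sqdom0 l); congr sqdom; apply/funext => x; rewrite big_nil.
by move: (sqdomD (fP i) IH); congr sqdom; apply/funext => x; rewrite big_cons.
Qed.

Definition mx_sqdom l p q (A : R -> 'M[C]_(p, q)) : Prop :=
  forall j k, sqdom l (fun x => A x j k).

Lemma mx_sqdomMr l p q r (A : R -> 'M[C]_(p, q)) (B : 'M[C]_(q, r)) :
  mx_sqdom l A -> mx_sqdom l (fun x => A x *m B).
Proof.
move=> AP j k.
have := sqdom_sum (index_enum 'I_q) (fun i => sqdomZ (B i k) (AP j i)).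
by congr sqdom; apply/funext => x; rewrite mxE.
Qed.

Lemma mx_sqdomB l p q (A B : R -> 'M[C]_(p, q)) :
  mx_sqdom l A -> mx_sqdom l B -> mx_sqdom l (fun x => A x - B x).
Proof.
move=> AP BP j k.
have := sqdomD (AP j k) (sqdomZ (-1) (BP j k)); congr sqdom.
by apply/funext => x; rewrite !mxE mulrN1.
Qed.

Lemma sum_sqdom l p (y : R -> 'cV[C]_p) : mx_sqdom l y -> exists S : R -> R,
  leb.-integrable `]l, +oo[ (EFin \o S) /\
  forall x, l < x -> \sum_j sqnorm (y x j 0) <= S x.
Proof.
move=> yP; have [S SP] := choice (fun j => yP j 0).
exists (fun x => \sum_j S j x); split.
  have := @integrable_sum _ _ _ leb `]l, +oo[ (measurable_itv _) _
    (index_enum 'I_p) xpredT (fun j x => (S j x)%:E) (fun j _ => (SP j).1).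
  by apply: eq_integrable => // x _ /=; rewrite sumEFin.
by move=> x lx; apply: ler_sum => j _; exact: (SP j).2.
Qed.

(** The ray has infinite measure, so already the constant d has infinite integral. *)
Lemma not_integrable_ray_ge l (S : R -> R) (d : R) : 0 < d ->
  (forall x, l < x -> d <= S x) -> ~ leb.-integrable `]l, +oo[ (EFin \o S).
Proof.
move=> d0 dS Si.
have m : measurable (`]l, +oo[ : set R) by exact: measurable_itv.
have : (\int[leb]_(x in `]l, +oo[) cst d%:E x <= \int[leb]_(x in `]l, +oo[) (S x)%:E)%E.
  apply: ge0_le_integral => //=.
  - by move=> x _; rewrite lee_fin ltW.
  - exact: measurable_int Si.
  - by move=> x; rewrite in_itv /= andbT lee_fin; exact: dS.
rewrite integral_cst// [X in (_ * X)%E](lebesgue_measure_itv `]l, +oo[).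
rewrite /= ltry addye// gt0_muley ?lte_fin//.
rewrite leye_eq => /eqP Soo.
by have := @integrable_fin_num _ _ _ leb _ m _ Si; rewrite Soo.
Qed.

(** * Squared Euclidean norms and the sign of y^* J y *)

Definition vnorm p (a : 'cV[C]_p) : R := \sum_j sqnorm (a j 0).

Lemma vnorm_ge0 p (a : 'cV[C]_p) : 0 <= vnorm a.
Proof. by apply: sumr_ge0 => j _; exact: sqnorm_ge0. Qed.

Lemma vnorm_le0 p (a : 'cV[C]_p) : vnorm a <= 0 -> a = 0.
Proof.
move=> a0; have /eqP : vnorm a = 0 by apply/eqP; rewrite eq_le a0 vnorm_ge0.
rewrite psumr_eq0 => [/allP aP|j _]; last exact: sqnorm_ge0.
apply/matrixP => j k; rewrite ord1 mxE; apply/eqP.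
by rewrite -sqnorm_eq0; apply: aP; rewrite mem_index_enum.
Qed.

Lemma vnorm0 p : vnorm (0 : 'cV[C]_p) = 0.
Proof. by rewrite /vnorm big1// => j _; apply/eqP; rewrite mxE sqnorm_eq0. Qed.

Lemma vnorm_split (y : 'cV[C]_(m1 + m2)) :
  vnorm y = vnorm (usubmx y) + vnorm (dsubmx y).
Proof.
by rewrite /vnorm big_split_ord; congr (_ + _); apply: eq_bigr => j _; rewrite mxE.
Qed.

Lemma adjmx_mulE p (a : 'cV[C]_p) : a^H *m a = ((vnorm a)%:C)%C%:M.
Proof.
apply/matrixP => j k; rewrite !ord1 !mxE eqxx mulr1n rmorph_sum /=.
apply: eq_bigr => i _; rewrite !mxE /sqnorm.
by case: (a i 0) => x y /=; apply/eqP; rewrite eq_complex /=;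
  apply/andP; split; apply/eqP; ring.
Qed.

Lemma J_formE (y : 'cV[C]_(m1 + m2)) :
  y^H *m J *m y = ((vnorm (usubmx y) - vnorm (dsubmx y))%:C)%C%:M.
Proof.
rewrite -[in LHS](vsubmxK y) /adjmx tr_col_mx map_row_mx /Jmx mul_row_block.
rewrite !mulmx0 mulmxN !mulmx1 addr0 add0r mul_row_col mulNmx.
by rewrite -!/(adjmx _) !adjmx_mulE -raddfB -rmorphB.
Qed.

(* y^* J y is nonincreasing along a solution and bounded below by -|y|^2: were it
   negative at l, |y|^2 would be bounded away from 0 on the whole ray. *)
Lemma L2_sol_vnorm_le z l (y : R -> 'cV[C]_(m1 + m2)) : 0 <= l -> 0 < Im z ->
  mprimitive y (fun x => dirac_coef v z x *m y x) -> mx_sqdom l y ->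
  vnorm (dsubmx (y l)) <= vnorm (usubmx (y l)).
Proof.
move=> l0 z0 yP yL; rewrite leNgt; apply/negP => yl.
have [S [Si yS]] := sum_sqdom yL.
pose d := vnorm (dsubmx (y l)) - vnorm (usubmx (y l)).
have d0 : 0 < d by rewrite subr_gt0.
apply: (not_integrable_ray_ge (l := l) d0 _ Si) => x lx.
apply: le_trans (yS x lx); rewrite -/(vnorm _).
have /cprimitiveP[qP _] := dirac_form yP yP 0 0.
have [_] := rprimitiveN qP l0 (ltW lx); rewrite /= !J_formE !mxE /=.
(* Since i(z - conj z) = -2 Im z, the negated density is 2 Im z |y(t)|^2, which is nonnegative on
   the upper half-plane. *)
have : 0 <= \int[leb]_(t in `[l, x]) (- Re
    ((('i%C * (z - conjc z)) *: ((y t)^H *m y t)) 0 0)).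
  apply: Rintegral_ge0 => t _; rewrite adjmx_mulE !mxE eqxx mulr1n.
  have := vnorm_ge0 (y t); case: z z0 {yP qP} => a b /= b0 n0.
  rewrite [leRHS](_ : _ = 2 * (b * vnorm (y t))); first by rewrite !mulr_ge0// ltW.
  by ring.
(* At x, the squared norm of the lower block minus that of the upper block is at least d, and
   |y(x)|^2 is no smaller than this difference. *)
rewrite vnorm_split /d; have := vnorm_ge0 (usubmx (y x)); lra.
Qed.

(** * From columns to matrices, and initial data in column form *)

Lemma mx_eq0_colP (F : fieldType) p q (A : 'M[F]_(p, q)) :
  (forall c : 'cV_q, A *m c = 0) -> A = 0.
Proof.
move=> A0; apply/matrixP => j k; have := A0 (delta_mx k 0).
by rewrite -colE => /matrixP/(_ j 0); rewrite !mxE.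
Qed.

(** [L2_sol_vnorm_le] speaks of single columns, so invertibility is tested on columns; the
    transposes appear because [kermx] is the kernel of the action on rows. *)
Lemma unitmx_colP (F : fieldType) p (A : 'M[F]_p) :
  (forall c : 'cV_p, A *m c = 0 -> c = 0) -> A \in unitmx.
Proof.
move=> A0; rewrite -unitmx_tr -row_free_unit -kermx_eq0; apply/rowV0P => c.
move=> /sub_kermxP /(congr1 trmx); rewrite trmx_mul trmxK trmx0 => /A0.
by move=> /(congr1 trmx); rewrite trmxK trmx0.
Qed.

Lemma mprimitive_solMr l u z p (B : 'M[C]_(m1 + m2, p)) : fund_sol v l u ->
  mprimitive (fun x => u x z *m B) (fun x => dirac_coef v z x *m (u x z *m B)).
Proof.
move=> uP j k; have := mprimitiveM (fund_sol_mprimitive z uP) (mprimitive_cst B) j k.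
by congr cprimitive; apply/funext => x; rewrite mulmx0 addr0 mulmxA.
Qed.

Lemma weyl_fun_sqdom l u (phi : C -> 'M[C]_(m2, m1)) z : weyl_fun l u phi -> 0 < Im z ->
  mx_sqdom l (fun x => u x z *m col_mx (1%:M : 'M[C]_m1) (phi z)).
Proof. by move=> [_ uL] z0 j k; exact/cL2_ray_sqdom/uL. Qed.

End Dirac.

(** * Transformation of the Weyl function under a shift of the left endpoint *)

Theorem theorem2p1 (R : realType) (m1 m2 : nat) (v : R -> 'M[R[i]]_(m1, m2))
  (hv : forall r : R, 0 < r -> forall j k, cintegrable `]0, r[ (fun x => v x j k))
  (l : R) (hl : 0 <= l)
  (u0 ul : R -> R[i] -> 'M[R[i]]_(m1 + m2))
  (hu0 : fund_sol v 0 u0) (hul : fund_sol v l ul)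
  (phi0 phil : R[i] -> 'M[R[i]]_(m2, m1))
  (hphi0 : weyl_fun 0 u0 phi0) (hphil : weyl_fun l ul phil) :
  forall z : R[i], 0 < complex.Im z ->
    (ulsubmx (u0 l z) + ursubmx (u0 l z) *m phi0 z) \in unitmx /\
    phil z = (dlsubmx (u0 l z) + drsubmx (u0 l z) *m phi0 z)
               *m invmx (ulsubmx (u0 l z) + ursubmx (u0 l z) *m phi0 z).
Proof.
move=> z z0.
set A := _ + _; set B := (X in _ /\ _ = X *m _).
(* The Weyl solution of [0,oo). Its value at l stacks the denominator [A] over the numerator [B] of
   the claimed quotient. *)
pose Y x := u0 x z *m col_mx (1%:M : 'M[R[i]]_m1) (phi0 z).
have YlE : Y l = col_mx A B.
  by rewrite /Y -[u0 l z]submxK mul_block_col !mulmx1.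
have YP : mprimitive Y (fun x => dirac_coef v z x *m Y x) by exact: mprimitive_solMr hu0.
have YL : mx_sqdom l Y.
  by move=> j k; apply: (sqdomS hl); exact: (weyl_fun_sqdom hphi0 z0).
have uA : A \in unitmx.
  (* If A c = 0, the solution Y c has zero upper block at l; domination then kills the lower block B
     c as well. *)
  apply: unitmx_colP => c Ac.
  have ycE : Y l *m c = col_mx 0 (B *m c) by rewrite YlE mul_col_mx Ac.
  have := @L2_sol_vnorm_le _ _ _ v z l (fun x => Y x *m c) hl z0 _ (mx_sqdomMr c YL).
  rewrite ycE col_mxKu col_mxKd vnorm0.
  have yP : mprimitive (fun x => Y x *m c) (fun x => dirac_coef v z x *m (Y x *m c)).
    move: (mprimitive_solMr z (col_mx 1%:M (phi0 z) *m c) hu0).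
    by congr mprimitive; apply/funext => x; rewrite /Y -!mulmxA.
  move=> /(_ yP)/vnorm_le0 Bc.
  have : Y l *m c = 0 by rewrite ycE Bc col_mx0.
  (* Cancelling the invertible u_0(l,z) leaves the column with blocks c and phi_0 c equal to zero,
     and its upper block is c. *)
  rewrite /Y => /(congr1 (mulmx (Jmx R m1 m2 *m (adjmx (u0 l (conjc z))) *m Jmx R m1 m2))).
  rewrite !mulmxA (fund_sol_inv z hu0 (lexx 0) hl) mul1mx mulmx0 mul_col_mx mul1mx.
  by move=> /(congr1 usubmx); rewrite col_mxKu linear0.
split=> //; apply/eqP; rewrite -subr_eq0; apply/eqP; apply: mx_eq0_colP => c.
(* The difference at l between the initial data of two candidates, (1, phi_l) and Y(l) A^{-1} = (1,
   B A^{-1}), applied to c; the identity blocks cancel. *)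
pose D := col_mx (0 : 'M[R[i]]_m1) (phil z - B *m invmx A) *m c.
have yL : mx_sqdom l (fun x => ul x z *m D).
  have := mx_sqdomMr c (mx_sqdomB (weyl_fun_sqdom hphil z0) (mx_sqdomMr (invmx A) YL)).
  move=> yL j k; have [S [Si yS]] := yL j k; exists S; split=> // x lx.
  have x0 : 0 <= x by rewrite (le_trans hl) ?ltW.
  (* As Y(x) = u_l(x,z) Y(l), the solution starting from [D] is a difference of two
     square-integrable ones. This representation is needed only at points x > l, where x is
     nonnegative. *)
  rewrite (_ : ul x z *m D = (ul x z *m col_mx 1%:M (phil z) - Y x *m invmx A) *m c).
    exact: yS.
  rewrite (sol_fund_sol hul hl x0 YP) YlE -mulmxA -mulmxBr -mulmxA; congr (_ *m _).
  rewrite /D; congr (_ *m _).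
  by rewrite mul_col_mx mulmxV// opp_col_mx add_col_mx subrr.
(* The zero upper block of [D] dominates its lower block, which is the difference of the two
   candidates applied to c. *)
have := L2_sol_vnorm_le hl z0 (mprimitive_solMr z D hul) yL.
by rewrite (hul z).1 mul1mx /D mul_col_mx mul0mx col_mxKu col_mxKd vnorm0 => /vnorm_le0.
Qed.
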